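(* Let $\Gamma\subseteq\mathbf{For}$ be a finite set of formulas and $\alpha\in\mathbf{For}$ a formula. Then $\alpha$ is an algebraic consequence of $\Gamma$ if and only if for every algebraic model $(\mathbf{BT},h)$ based on the finite $HT$-algebra $\mathbf{BT}$, $h(\gamma)=1$ for all $\gamma\in\Gamma$ implies $h(\alpha)=1$; that is, $$\Gamma\models_{Alg}\alpha\quad\text{if and only if}\quad\Gamma\models_{BT}\alpha .$$
   Context: Language. $\mathbf{VarProp}$ is a countable set of propositional variables. $\mathbf{For}$ is the least set containing $\mathbf{VarProp}$ and closed under the binary connectives $\wedge,\vee,\Rightarrow$ and the unary connectives $\neg,S_1,S_2$ (the freely generated set of formulas). HT-algebras. An $HT$-algebra is an algebra $A=(A,0,1,\wedge,\vee,\Rightarrow,\neg,S_1,S_2)$ such that $(A,0,1,\wedge,\vee,\Rightarrow,\neg)$ is a Heyting algebra (with $\neg a=a\Rightarrow 0$), and for all $a,b\in A$ and all $i,j\in\{1,2\}$: $S_i(a\wedge b)=S_ia\wedge S_ib$; $S_i(a\vee b)=S_ia\vee S_ib$; $S_2(a\Rightarrow b)=(S_2a\Rightarrow S_2b)$; $S_1(a\Rightarrow b)=(S_1a\Rightarrow S_1b)\wedge(S_2a\Rightarrow S_2b)$; $S_iS_ja=S_ja$; $S_1a\vee a=a$; $S_1a\vee\neg S_1a=1$. Algebraic semantics. An algebraic model is a pair $(A,h)$ where $A$ is an $HT$-algebra and $h:\mathbf{For}\to A$ is a homomorphism, i.e. $h$ preserves $\wedge,\vee,\Rightarrow,\neg,S_1,S_2$.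 $\Gamma\models_{Alg}\alpha$ means: for every algebraic model $(A,h)$, if $h(\gamma)=1$ for all $\gamma\in\Gamma$, then $h(\alpha)=1$. $\Gamma\models_{BT}\alpha$ means the same with $A$ restricted to be $\mathbf{BT}$ ($h$ arbitrary). The algebra $\mathbf{BT}$. Let $T=\{t_1,t_2\}$ be a two-element ordered set with $t_1\le t_2$, $t_1\ne t_2$, and for $t\in T$ let $F(t)=\{w\in T: t\le w\}$. The underlying set of $\mathbf{BT}$ is $\{\emptyset,F(t_2),F(t_1)\}$ (so $F(t_1)=T$), a three-element chain under inclusion, with $0=\emptyset$, $1=T$, $\wedge=\cap$, $\vee=\cup$; for $X$ in this set, $S_i(X)=S_{t_i}(X)=T$ if $t_i\in X$ and $\emptyset$ otherwise; $CX$ is the set complement in $T$ of $S_1(X)$; $X\Rightarrow Y=Y\cup\bigcap_{k=1}^{2}(CS_kX\cup S_kY)$, and $\neg X=X\Rightarrow\emptyset$. *)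

(* Defs.v *)
From HB Require Import structures.
From mathcomp Require classical_sets cardinality.
From mathcomp Require Import all_boot all_order.

Set Implicit Arguments.
Unset Strict Implicit.
Unset Printing Implicit Defensive.

Import Order.LTheory Order.DefaultSetSubsetOrder.
Local Open Scope order_scope.

(* The indices 1, 2 of S_1, S_2, which also serve as the points t_1 <= t_2 of
   the ordered set T; as a natural number the index i is i - 1. *)
Notation idx := 'I_2.
Definition i1 : idx := ord0.
Definition i2 : idx := ord_max.

Inductive form (V : Type) : Type :=
  | Var of V
  | And of form V & form V
  | Or of form V & form V
  | Imp of form V & form V
  | Neg of form V
  | Sop of idx & form V.

(* A bounded lattice with a relative pseudo-complement is distributive, so
   starting from bounded distributive lattices is no restriction. *)
HB.mixin Record isHeyting d T of Order.TBDistrLattice d T := {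
  himp : T -> T -> T;
  himpP : forall a b c : T, (c <= himp a b) = (c `&` a <= b)
}.

#[short(type="heytingType")]
HB.structure Definition Heyting d :=
  { T of isHeyting d T & Order.TBDistrLattice d T }.

Definition hneg {d} {A : heytingType d} (a : A) : A := himp a \bot.

HB.mixin Record isHT d T of Heyting d T := {
  htS : idx -> T -> T;
  htSI : forall i (a b : T), htS i (a `&` b) = htS i a `&` htS i b;
  htSU : forall i (a b : T), htS i (a `|` b) = htS i a `|` htS i b;
  htS2imp : forall a b : T, htS i2 (himp a b) = himp (htS i2 a) (htS i2 b);
  htS1imp : forall a b : T,
    htS i1 (himp a b)
    = himp (htS i1 a) (htS i1 b) `&` himp (htS i2 a) (htS i2 b);
  htSS : forall i j (a : T), htS i (htS j a) = htS j a;
  htS1U : forall a : T, htS i1 a `|` a = a;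
  htS1EM : forall a : T, htS i1 a `|` hneg (htS i1 a) = \top
}.

#[short(type="htAlgType")]
HB.structure Definition HTAlg d := { T of isHT d T & Heyting d T }.

Record is_hom (V : Type) d (A : htAlgType d) (h : form V -> A) : Prop := IsHom {
  hom_and : forall x y, h (And x y) = h x `&` h y;
  hom_or : forall x y, h (Or x y) = h x `|` h y;
  hom_imp : forall x y, h (Imp x y) = himp (h x) (h y);
  hom_neg : forall x, h (Neg x) = hneg (h x);
  hom_S : forall i x, h (Sop i x) = htS i (h x)
}.

Definition conseq_in (V : Type) d (A : htAlgType d)
    (Gamma : classical_sets.set (form V)) (alpha : form V) : Prop :=
  forall h : form V -> A, is_hom h ->
    (forall gamma, Gamma gamma -> h gamma = \top) -> h alpha = \top.

Definition conseq_alg (V : Type) (Gamma : classical_sets.set (form V)) (alpha : form V) : Prop :=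
  forall d (A : htAlgType d), conseq_in A Gamma alpha.

Definition upF (t : idx) : {set idx} := [set w : idx | t <= w].

(* The three upward closed sets: the empty set, {t_2} and T. *)
Definition BTpred : {pred {set idx}} :=
  fun X => X \in [:: set0; upF i2; upF i1].

Fact BT_display : Order.disp_t. Proof. exact. Qed.

Record BT : Type := MkBT { BTval :> {set idx}; BTvalP : BTval \in BTpred }.

HB.instance Definition _ := [isSub for BTval].
HB.instance Definition _ := [Finite of BT by <:].

Definition setS (i : idx) (X : {set idx}) : {set idx} :=
  if i \in X then setT else set0.
(* The operator C of the algebra BT: the complement of S_1 X, not of X. *)
Definition setNS1 (X : {set idx}) : {set idx} := ~: setS i1 X.
Definition setImp (X Y : {set idx}) : {set idx} :=
  Y :|: \bigcap_(k : idx) (setNS1 (setS k X) :|: setS k Y).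

Lemma BTpredE (X : {set idx}) :
  (X \in BTpred) = ((i1 \in X) ==> (i2 \in X)).
Proof.
have e (Y Z : {set idx}) :
    (Y == Z) = ((i1 \in Y) == (i1 \in Z)) && ((i2 \in Y) == (i2 \in Z)).
  apply/eqP/andP => [->|[/eqP h1 /eqP h2]]; first by rewrite !eqxx.
  apply/setP => -[[|[|n]] Hn] //.
  - by rewrite (_ : Ordinal Hn = i1) //; apply: val_inj.
  - by rewrite (_ : Ordinal Hn = i2) //; apply: val_inj.
rewrite -[LHS]/(X \in [:: set0; upF i2; upF i1]) !inE !e !inE.
by case: (i1 \in X); case: (i2 \in X).
Qed.

Lemma in_setS j i X : (j \in setS i X) = (i \in X).
Proof. by rewrite /setS; case: ifP; rewrite inE. Qed.

Lemma in_setImp j X Y : (j \in setImp X Y) =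
  (j \in Y) || (((i1 \in X) ==> (i1 \in Y)) && ((i2 \in X) ==> (i2 \in Y))).
Proof.
rewrite !inE; congr (_ || _).
apply/bigcapP/andP => [H|[h1 h2] k _].
  by split; [have := H i1 isT|have := H i2 isT]; rewrite !inE !in_setS implybE.
rewrite !inE !in_setS -implybE.
case: k => -[|[|n]] Hn //.
- by rewrite (_ : Ordinal Hn = i1) //; apply: val_inj.
- by rewrite (_ : Ordinal Hn = i2) //; apply: val_inj.
Qed.

Lemma BTpredI : {in BTpred &, forall X Y, X `&` Y \in BTpred}.
Proof.
move=> X Y; rewrite -[X `&` Y]/(X :&: Y) !BTpredE !inE.
by case: (i1 \in X); case: (i2 \in X); case: (i1 \in Y); case: (i2 \in Y).
Qed.

Lemma BTpredU : {in BTpred &, forall X Y, X `|` Y \in BTpred}.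
Proof.
move=> X Y; rewrite -[X `|` Y]/(X :|: Y) !BTpredE !inE.
by case: (i1 \in X); case: (i2 \in X); case: (i1 \in Y); case: (i2 \in Y).
Qed.

Lemma BTpred0 : \bot \in BTpred.
Proof. by rewrite (BTpredE set0) !inE. Qed.

Lemma BTpred1 : \top \in BTpred.
Proof. by rewrite (BTpredE setT) !inE. Qed.

(* Order, meet, join, bottom and top are inclusion, intersection, union, the
   empty set and T, restricted to BT. *)
HB.instance Definition _ := Order.SubChoice_isTBSubLattice.Build
  _ _ BTpred BT_display BT BTpredI BTpredU BTpred0 BTpred1.

Lemma BTmeetUl : @left_distributive BT BT Order.meet Order.join.
Proof. by move=> x y z; apply: val_inj; exact: setIUl. Qed.

HB.instance Definition _ :=
  Order.Lattice_Meet_isDistrLattice.Build BT_display BT BTmeetUl.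

Lemma setImp_BT (X Y : BT) : setImp X Y \in BTpred.
Proof.
have := BTvalP X; have := BTvalP Y; rewrite !BTpredE !in_setImp.
by case: (i1 \in BTval X); case: (i2 \in BTval X);
   case: (i1 \in BTval Y); case: (i2 \in BTval Y).
Qed.

Lemma setS_BT i (X : BT) : setS i X \in BTpred.
Proof. by rewrite BTpredE !in_setS implybb. Qed.

Definition BTimp (X Y : BT) : BT := MkBT (setImp_BT X Y).
Definition BTS (i : idx) (X : BT) : BT := MkBT (setS_BT i X).

Lemma BT_eqP (X Y : BT) :
  (i1 \in BTval X) = (i1 \in BTval Y) ->
  (i2 \in BTval X) = (i2 \in BTval Y) -> X = Y.
Proof.
move=> h1 h2; apply: val_inj; apply/setP => -[[|[|n]] Hn] //.
- by rewrite (_ : Ordinal Hn = i1) //; apply: val_inj.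
- by rewrite (_ : Ordinal Hn = i2) //; apply: val_inj.
Qed.

Lemma in_BTmeet j (X Y : BT) :
  (j \in BTval (X `&` Y)) = (j \in BTval X) && (j \in BTval Y).
Proof. exact: in_setI. Qed.

Lemma in_BTjoin j (X Y : BT) :
  (j \in BTval (X `|` Y)) = (j \in BTval X) || (j \in BTval Y).
Proof. exact: in_setU. Qed.

Lemma in_BTbot j : (j \in BTval \bot) = false.
Proof. exact: in_set0. Qed.

Lemma in_BTtop j : (j \in BTval \top) = true.
Proof. exact: in_setT. Qed.

Lemma in_BTimp j (X Y : BT) : (j \in BTval (BTimp X Y)) = (j \in BTval Y) ||
  (((i1 \in BTval X) ==> (i1 \in BTval Y))
  && ((i2 \in BTval X) ==> (i2 \in BTval Y))).
Proof. exact: in_setImp. Qed.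

Lemma in_BTS j i (X : BT) : (j \in BTval (BTS i X)) = (i \in BTval X).
Proof. exact: in_setS. Qed.

Lemma BTmono (X : BT) : (i1 \in BTval X) ==> (i2 \in BTval X).
Proof. by rewrite -BTpredE BTvalP. Qed.

Lemma le_BT (X Y : BT) : (X <= Y) =
  ((i1 \in BTval X) ==> (i1 \in BTval Y))
  && ((i2 \in BTval X) ==> (i2 \in BTval Y)).
Proof.
rewrite leEmeet; apply/eqP/andP => [e|[h1 h2]].
  split; apply/implyP; rewrite -e in_BTmeet; case/andP=> // *.
by apply: BT_eqP; rewrite in_BTmeet; [move: h1|move: h2]; do 2!case: (_ \in _).
Qed.

Definition BTE := (in_BTmeet, in_BTjoin, in_BTbot, in_BTtop, in_BTimp, in_BTS).

Lemma BTimpP (X Y Z : BT) : (Z <= BTimp X Y) = (Z `&` X <= Y).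
Proof.
rewrite !le_BT !BTE; move: (BTmono X) (BTmono Y) (BTmono Z).
by do 6!case: (_ \in _).
Qed.

HB.instance Definition _ := isHeyting.Build BT_display BT BTimpP.

Lemma BThimpE (X Y : BT) : himp X Y = BTimp X Y. Proof. by []. Qed.

Ltac BTcases := intros; apply: BT_eqP;
  rewrite /hneg ?BThimpE !BTE; repeat (case: (_ \in _) => //).

Lemma BTSI i (X Y : BT) : BTS i (X `&` Y) = BTS i X `&` BTS i Y.
Proof. BTcases. Qed.

Lemma BTSU i (X Y : BT) : BTS i (X `|` Y) = BTS i X `|` BTS i Y.
Proof. BTcases. Qed.

Lemma BTS2imp (X Y : BT) : BTS i2 (himp X Y) = himp (BTS i2 X) (BTS i2 Y).
Proof.
apply: BT_eqP; rewrite ?BThimpE !BTE; move: (BTmono X) (BTmono Y);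
by do 4!case: (_ \in _).
Qed.

Lemma BTS1imp (X Y : BT) : BTS i1 (himp X Y) =
  himp (BTS i1 X) (BTS i1 Y) `&` himp (BTS i2 X) (BTS i2 Y).
Proof.
apply: BT_eqP; rewrite ?BThimpE !BTE; move: (BTmono X) (BTmono Y);
by do 4!case: (_ \in _).
Qed.

Lemma BTSS i j (X : BT) : BTS i (BTS j X) = BTS j X.
Proof. BTcases. Qed.

Lemma BTS1U (X : BT) : BTS i1 X `|` X = X.
Proof.
by apply: BT_eqP; rewrite !BTE; move: (BTmono X); do 2!case: (_ \in _).
Qed.

Lemma BTS1EM (X : BT) : BTS i1 X `|` hneg (BTS i1 X) = \top.
Proof. BTcases. Qed.

HB.instance Definition _ := isHT.Build BT_display BT
  BTSI BTSU BTS2imp BTS1imp BTSS BTS1U BTS1EM.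

Definition conseq_BT (V : Type) (Gamma : classical_sets.set (form V))
    (alpha : form V) : Prop := conseq_in BT Gamma alpha.

(* Main.v *)
(** By [htS1U] and [htS1EM], an element [x] of an HT-algebra is [\top] as soon
    as [htS i1 x] is, and [htS i1 x] is complemented.  So if a model [h] refutes
    [alpha], then [hneg (htS i1 (h alpha))] is nonzero.  Shrink it to a nonzero
    [d] that lies below [htS i (h p)] or below its negation for each of the
    finitely many variables [p] in play; such a [d] replaces an ultrafilter of
    the Boolean algebra of the [htS i x].  The valuation [p |-> {t_i | d <=
    htS i (h p)}] into BT then refutes [alpha] as well. *)
Require Import Defs.
From mathcomp Require Import all_boot all_order.
From mathcomp Require Import boolp.
From mathcomp Require classical_sets cardinality.

Set Implicit Arguments.
Unset Strict Implicit.
Unset Printing Implicit Defensive.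

Import Order.LTheory.
Local Open Scope order_scope.

Section Heyting.
Context {disp} {A : heytingType disp}.
Implicit Types (d x y : A) (b : bool).

Lemma le_hneg d x : (d <= hneg x) = (d `&` x == \bot).
Proof. by rewrite himpP lex0. Qed.

(** [b] is the truth value that [d] gives to [x]: a nonzero [d] gives at most one, and none if it
    lies below neither [x] nor [hneg x]. *)
Definition forces d b x : bool := d <= if b then x else hneg x.

Lemma forcesW d d' b x : d' <= d -> forces d b x -> forces d' b x.
Proof. exact: le_trans. Qed.

Lemma forces_inj d b b' x :
  d != \bot -> forces d b x -> forces d b' x -> b = b'.
Proof.
move=> d_neq0; rewrite /forces; case: b; case: b' => //; rewrite le_hneg.
  by rewrite leEmeet => /eqP-> /eqP d0; rewrite d0 eqxx in d_neq0.
by move=> d0; rewrite leEmeet (eqP d0) => /eqP d0'; rewrite -d0' eqxx in d_neq0.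
Qed.

Lemma forces_meet d b c x y :
  forces d b x -> forces d c y -> forces d (b && c) (x `&` y).
Proof.
rewrite /forces; case: b; case: c => /=; rewrite ?le_hneg ?lexI.
- by move=> -> ->.
- by move=> _ /eqP dy; rewrite (meetC x) meetA dy meet0x.
- by move=> /eqP dx _; rewrite meetA dx meet0x.
- by move=> /eqP dx _; rewrite meetA dx meet0x.
Qed.

Lemma forces_join d b c x y :
  forces d b x -> forces d c y -> forces d (b || c) (x `|` y).
Proof.
rewrite /forces; case: b; case: c => /=; rewrite ?le_hneg.
- by move=> dx _; rewrite lexUl.
- by move=> dx _; rewrite lexUl.
- by move=> _ dy; rewrite lexUr.
- by move=> /eqP dx /eqP dy; rewrite meetUr dx dy joinx0.
Qed.

Lemma forces_himp d b c x y :
  forces d b x -> forces d c y -> forces d (b ==> c) (himp x y).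
Proof.
rewrite /forces; case: b; case: c => /=; rewrite ?le_hneg ?himpP.
- by move=> _ dy; rewrite leIxl.
(* Modus ponens: as [d] lies below [x], its meet with [himp x y] lies below [y], hence below the
   meet of [d] and [y], which is [\bot]. *)
- move=> dx /eqP dy; rewrite -lex0 -dy lexI leIl /=.
  have : himp x y `&` x <= y by rewrite -himpP.
  by apply: le_trans; rewrite lexI leIr leIxl.
- by move=> _ dy; rewrite leIxl.
- by move=> /eqP-> _; rewrite le0x.
Qed.

Lemma forces_bot d : forces d false \bot.
Proof. by rewrite /forces le_hneg meetx0. Qed.

(** The [f i] are decided one at a time by shrinking [c]; by [forcesW] a decision persists below. *)
Lemma exists_forcing (I : eqType) (s : seq I) (f : I -> A) c :
  c != \bot -> exists d, [/\ d != \bot, d <= c &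
    forall i, i \in s -> forces d (d <= f i) (f i)].
Proof.
elim: s c => [|j s IHs] c c_neq0; first by exists c; rewrite lexx.
have [d [d_neq0 le_dc decide_j]] : exists d, [/\ d != \bot, d <= c &
    forces d true (f j) || forces d false (f j)].
  (* Either [c] already lies below [hneg (f j)], or its nonzero meet with [f j] serves. *)
  rewrite /forces; have [cj0|cj_neq0] := eqVneq (c `&` f j) \bot.
    by exists c; rewrite lexx le_hneg cj0 eqxx orbT.
  by exists (c `&` f j); rewrite leIl leIr.
have [e [e_neq0 le_ed decide_s]] := IHs d d_neq0.
exists e; split => // [|i]; first exact: le_trans le_ed le_dc.
rewrite inE => /predU1P[->|]; last exact: decide_s.
case/orP: decide_j => /(forcesW le_ed) decide_j; rewrite /forces.
  by rewrite ifT.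
by case: ifP.
Qed.

End Heyting.

Section HT.
Context {disp} {A : htAlgType disp}.
Implicit Types (x : A).

Lemma htS_bot i : htS i (\bot : A) = \bot.
Proof.
have S10 : htS i1 (\bot : A) = \bot by rewrite -[RHS](htS1U \bot) joinx0.
(* [\bot] is a value of [htS i1], and every [htS i] fixes such values. *)
by rewrite -{1}S10 htSS.
Qed.

Lemma ord2P (i : idx) : i = i1 \/ i = i2.
Proof.
by case: i => -[|[|]] // ?; [left|right]; apply: val_inj.
Qed.

Lemma himpxx x : himp x x = \top.
Proof. by apply/eqP; rewrite -le1x himpP leIr. Qed.

Lemma htS_top i : htS i (\top : A) = \top.
Proof.
rewrite -(himpxx \bot).
by case: (ord2P i) => ->; rewrite ?htS1imp ?htS2imp !htS_bot !himpxx ?meetxx.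
Qed.

Lemma htS1_eq1 x : htS i1 x = \top -> x = \top.
Proof. by move=> e; have := htS1U x; rewrite e join1x. Qed.

Lemma htS1_hneg_eq0 x : hneg (htS i1 x) = \bot -> x = \top.
Proof. by move=> e; apply: htS1_eq1; rewrite -(htS1EM x) e joinx0. Qed.

End HT.

Fixpoint vars (V : Type) (b : form V) : seq V :=
  match b with
  | Var p => [:: p]
  | And x y | Or x y | Imp x y => vars x ++ vars y
  | Neg x | Sop _ x => vars x
  end.

Fixpoint eval (V : Type) disp (A : htAlgType disp) (v : V -> A) (b : form V) :
    A :=
  match b with
  | Var p => v p
  | And x y => eval v x `&` eval v y
  | Or x y => eval v x `|` eval v y
  | Imp x y => himp (eval v x) (eval v y)
  | Neg x => hneg (eval v x)
  | Sop i x => htS i (eval v x)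
  end.

Lemma eval_hom (V : Type) disp (A : htAlgType disp) (v : V -> A) :
  is_hom (eval v).
Proof. by []. Qed.

Section Reflection.
Context {V : eqType} {disp} {A : htAlgType disp}.
Variables (h : form V -> A) (d : A).
Hypothesis h_hom : is_hom h.

Definition traceSet (x : A) : {set idx} := [set i | d <= htS i x].

(* [htS i1 x = htS i2 (htS i1 x) <= htS i2 x], since [htS i1 x <= x]. *)
Lemma traceSet_BT (x : A) : traceSet x \in BTpred.
Proof.
rewrite BTpredE !inE; apply/implyP => /le_trans; apply.
by rewrite leEjoin -(htSS i2 i1) -htSU htS1U.
Qed.

Definition trace (x : A) : BT := MkBT (traceSet_BT x).

(** Since [X] and [Y] are upward closed, [i1] is in [himp X Y] iff the implication of bits holds at
    both indices, and [i2] iff it holds at [i2]; this matches [htS1imp] and [htS2imp]. *)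
Lemma forces_imp (X Y : BT) (x y : A) :
    (forall i, forces d (i \in BTval X) (htS i x)) ->
    (forall i, forces d (i \in BTval Y) (htS i y)) ->
  forall i, forces d (i \in BTval (himp X Y)) (htS i (himp x y)).
Proof.
move=> fX fY i; rewrite BThimpE in_BTimp.
have f1 := forces_himp (fX i1) (fY i1); have f2 := forces_himp (fX i2) (fY i2).
case: (ord2P i) => ->.
  rewrite htS1imp; move: (forces_meet f1 f2) (BTmono Y).
  by do 4!case: (_ \in _).
rewrite htS2imp; move: f2 (BTmono X) (BTmono Y).
by do 4!case: (_ \in _).
Qed.

(** Truth lemma, by induction on [b]; at a variable, membership in the trace is by definition the
    decision of [d]. *)
Lemma forces_eval (b : form V) :
    (forall p i, p \in vars b ->
      forces d (d <= htS i (h (Var p))) (htS i (h (Var p)))) ->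
  forall i, forces d (i \in BTval (eval (fun p => trace (h (Var p))) b))
    (htS i (h b)).
Proof.
have catl (s t : seq V) p : p \in s -> p \in s ++ t by rewrite mem_cat => ->.
have catr (s t : seq V) p : p \in t -> p \in s ++ t.
  by rewrite mem_cat orbC => ->.
elim: b => [p|x IHx y IHy|x IHx y IHy|x IHx y IHy|x IHx|j x IHx] /= decide.
- by move=> i; rewrite inE; apply: decide; rewrite inE.
- move=> i; rewrite in_BTmeet (hom_and h_hom) htSI.
  apply: forces_meet; [apply: IHx | apply: IHy] => p k pv; apply: decide;
    by [exact: catl | exact: catr].
- move=> i; rewrite in_BTjoin (hom_or h_hom) htSU.
  apply: forces_join; [apply: IHx | apply: IHy] => p k pv; apply: decide;
    by [exact: catl | exact: catr].
- rewrite (hom_imp h_hom); apply: forces_imp; [apply: IHx | apply: IHy];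
    move=> p k pv; apply: decide; by [exact: catl | exact: catr].
- rewrite (hom_neg h_hom) /hneg; apply: (@forces_imp _ \bot _ \bot);
    first exact: IHx.
  by move=> i; rewrite in_BTbot htS_bot forces_bot.
- by move=> i; rewrite in_BTS (hom_S h_hom) htSS; apply: IHx.
Qed.

End Reflection.

Lemma finite_vars (V : eqType) (Gamma : classical_sets.set (form V)) :
  cardinality.finite_set Gamma ->
  exists s : seq V, forall b, Gamma b -> {subset vars b <= s}.
Proof.
move=> finG.
(* [{classic form V}] equips formulas with the decidable equality that membership in a list
   requires. *)
have [t Gt] : exists t : seq {classic form V},
    Gamma = (fun b => b \in t).
  exact/(@cardinality.finite_seqP {classic form V} Gamma).
exists (flatten [seq vars b | b <- t]) => b Gb p pb.
rewrite Gt in Gb; apply/flattenP; exists (vars b) => //.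
exact: (map_f (@vars V : {classic form V} -> seq V)).
Qed.

Theorem theorem6p1 (V : countType)
    (Gamma : classical_sets.set (form V)) (alpha : form V) :
  cardinality.finite_set Gamma ->
  conseq_alg Gamma alpha <-> conseq_BT Gamma alpha.
Proof.
move=> /finite_vars[s varsG]; split=> [|BTalpha disp A h h_hom hG]; first exact.
apply: htS1_hneg_eq0; apply/eqP/negPn/negP => h_alpha.
(* A pair [(p, i)] stands for the element [htS i (h (Var p))] to be decided. *)
have [d [d_neq0 d_alpha decide]] := exists_forcing
  (allpairs pair (vars alpha ++ s) (enum idx))
  (fun pi => htS pi.2 (h (Var pi.1))) h_alpha.
pose g := eval (fun p => trace d (h (Var p))).
have forced b i : {subset vars b <= vars alpha ++ s} ->
    forces d (i \in BTval (g b)) (htS i (h b)).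
  move=> sub; apply: forces_eval => // p k /sub ps.
  by apply: (decide (p, k)); rewrite allpairs_f // mem_enum.
have g_alpha : g alpha = \top.
  apply: BTalpha; first exact: eval_hom.
  move=> b Gb; suff top i : i \in BTval (g b).
    by apply: BT_eqP; rewrite in_BTtop top.
  (* As [h b] is [\top], [d] forces [htS i (h b)] true, and a nonzero [d] forces only one value. *)
  apply: (forces_inj d_neq0 (forced b i _)) => [p pb|].
    by rewrite mem_cat (varsG b Gb) ?orbT.
  by rewrite hG // htS_top /forces lex1.
(* This contradicts [d_alpha], which puts [d] below the negation. *)
have : forces d true (htS i1 (h alpha)).
  rewrite -(in_BTtop i1) -g_alpha; apply: forced => p pa.
  by rewrite mem_cat pa.
by move/(forces_inj d_neq0)/(_ (d_alpha : forces d false _)).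
Qed.
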